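(* Let $\langle \pi, \equiv_\pi \rangle$ be a fair and strong smn abstract semantics, and let $n\geq 1$. If $A\subseteq\mathbb{N}$ is partially $\sim_\pi^n$-extensional and not universally $\sim_\pi^n$-extensional, then $A$ is not recursive.
   Context: Fix a Turing-complete programming model with a Gödel numbering of its programs; $\phi_a^{(n)}:\mathbb{N}^n\rightharpoonup\mathbb{N}$ denotes the $n$-ary partial function computed by the $a$-th program, and every $n$-ary partial recursive function equals some $\phi_a^{(n)}$. Let $\mathcal{F}$ denote the class of all partial functions $\mathbb{N}^n\rightharpoonup\mathbb{N}$, $n\in\mathbb{N}$. An abstract semantics is a pair $\langle\pi,\equiv_\pi\rangle$ where $\pi$ assigns to each index $a$ and arity $n$ a partial function $\pi_a^{(n)}:\mathbb{N}^n\rightharpoonup\mathbb{N}$, and $\equiv_\pi$ is an equivalence relation on $\mathcal{F}$; $a\sim_\pi^n b$ iff $\pi_a^{(n)}\equiv_\pi\pi_b^{(n)}$. Strong smn: for all $m,n\ge1$ there is a total computable $s:\mathbb{N}^{m+2}\to\mathbb{N}$ with $\lambda\vec y.\,\pi_a^{(n+1)}(\phi_b^{(m)}(\vec x),\vec y)\equiv_\pi\pi_{s(a,b,\vec x)}^{(n)}$ for all $a,b\in\mathbb{N}$, $\vec x\in\mathbb{N}^m$. Fair: for every arity $n$ there is $u$ with $\pi_a^{(n)}\equiv_\pi\lambda\vec y.\,\pi_u^{(n+1)}(a,\vec y)$ for all $a$. For an equivalence $\sim$ on $\mathbb{N}$ with classes $[a]_\sim$, a set $A\subseteq\mathbb{N}$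 is partially $\sim$-extensional if $[a]_\sim\subseteq A$ for some $a\in\mathbb{N}$, and universally $\sim$-extensional if $[a]_\sim\cap A\neq\varnothing$ for all $a\in\mathbb{N}$. *)

(* Defs.v *)
From Stdlib Require Import Relations.
From mathcomp Require Import all_boot.

Set Implicit Arguments.
Unset Strict Implicit.
Unset Printing Implicit Defensive.

(* Partial functions nat^n -> nat; None means "undefined". *)
Definition pfun (n : nat) : Type := n.-tuple nat -> option nat.

Definition anyfun : Type := {n : nat & pfun n}.

Definition anyf (n : nat) (f : pfun n) : anyfun := existT pfun n f.

Inductive code : nat -> Type :=
| Zero n : code n
| Succ : code 1
| Proj n (i : 'I_n) : code n
| Comp m n (f : code m) (g : 'I_m -> code n) : code n
| Prec n (f : code n) (g : code n.+2) : code n.+1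
| Mu n (f : code n.+1) : code n.

(* [eval c x v]: the function described by c is defined at x, with value v.
   Prec f g is the h with h(0, y) = f(y) and h(k+1, y) = g(k, h(k, y), y). *)
Fixpoint eval n (c : code n) : n.-tuple nat -> nat -> Prop :=
  match c in code n return n.-tuple nat -> nat -> Prop with
  | Zero _ => fun _ v => v = 0
  | Succ => fun x v => v = (thead x).+1
  | Proj _ i => fun x v => v = tnth x i
  | Comp m _ f g => fun x v =>
      exists w : m.-tuple nat,
        (forall i, eval (g i) x (tnth w i)) /\ eval f w v
  | Prec _ f g => fun x =>
      let y := [tuple of behead x] in
      (fix rec k v := match k with
         | 0 => eval f y v
         | j.+1 => exists w, rec j w /\ eval g [tuple of j :: w :: y] v
         end) (thead x)
  | Mu _ f => fun x v =>
      eval f [tuple of v :: x] 0 /\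
      forall j, j < v -> exists k, eval f [tuple of j :: x] k.+1
  end.

Definition partial_recursive n (f : pfun n) : Prop :=
  exists c : code n, forall x v, f x = Some v <-> eval c x v.

Definition total_computable n (f : n.-tuple nat -> nat) : Prop :=
  partial_recursive (fun x => Some (f x)).

Definition recursive (A : nat -> Prop) : Prop :=
  exists chi : 1.-tuple nat -> nat, total_computable chi /\
    forall a, (A a -> chi [tuple a] = 1) /\ (~ A a -> chi [tuple a] = 0).

Unset Implicit Arguments.

(* An arbitrary Turing-complete programming model with numbered programs:
   [prog a n] is the n-ary function computed by the a-th program. *)
Record programming_model := ProgrammingModel {
  prog :> forall a n : nat, pfun n;
  prog_recursive : forall a n, partial_recursive (prog a n);
  prog_complete : forall n (f : pfun n),
    partial_recursive f -> exists a, prog a n =1 f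
}.

Record abstract_semantics := AbstractSemantics {
  sem :> forall a n : nat, pfun n;
  sem_eq : relation anyfun;
  sem_eq_equiv : equivalence anyfun sem_eq
}.

Set Implicit Arguments.

Definition sim (pi : abstract_semantics) (n : nat) : relation nat :=
  fun a b => sem_eq pi (anyf (pi a n)) (anyf (pi b n)).

(* The partial function y |-> f(o, y), undefined everywhere if o is. *)
Definition papply n (f : pfun n.+1) (o : option nat) : pfun n :=
  fun y => if o is Some v then f [tuple of v :: y] else None.

Definition strong_smn (phi : programming_model) (pi : abstract_semantics) :
    Prop :=
  forall m n, 1 <= m -> 1 <= n ->
    exists s : m.+2.-tuple nat -> nat, total_computable s /\
      forall (a b : nat) (x : m.-tuple nat),
        sem_eq pi (anyf (papply (pi a n.+1) (phi b m x)))
                  (anyf (pi (s [tuple of a :: b :: x]) n)).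

Definition fair (pi : abstract_semantics) : Prop :=
  forall n, exists u, forall a,
    sem_eq pi (anyf (pi a n)) (anyf (papply (pi u n.+1) (Some a))).

Definition partially_extensional (R : relation nat) (A : nat -> Prop) : Prop :=
  exists a, forall b, R a b -> A b.

Definition universally_extensional (R : relation nat) (A : nat -> Prop) :
    Prop :=
  forall a, exists b, R a b /\ A b.

(* Main.v *)
(** Kleene's recursion theorem holds up to [sim pi n]: if [f] is total
    computable, [u] is universal for arity [n] and [b] is a program for
    [x |-> f (s (u, x, x))], then [p := s (u, b, b)] satisfies
    [sim pi n p (f p)].  If [A] were recursive and some class avoided [A], take
    for [f] the function sending elements of [A] into that class and the others
    into a class contained in [A]: its fixed point is in [A] iff it is not. *)
Require Import Defs.
From Stdlib Require Import Classical.
From mathcomp Require Import all_boot.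

Set Implicit Arguments.
Unset Strict Implicit.
Unset Printing Implicit Defensive.

Lemma eq_total_computable n (f g : n.-tuple nat -> nat) :
  f =1 g -> total_computable f -> total_computable g.
Proof. by move=> fg [c cP]; exists c => x v; rewrite -fg. Qed.

Lemma total_computable_proj n (i : 'I_n) :
  total_computable (fun x => tnth x i).
Proof. by exists (Proj i) => x v; split=> [[<-]|/= ->]. Qed.

Lemma total_computable_comp m n (f : m.-tuple nat -> nat)
    (g : 'I_m -> n.-tuple nat -> nat) :
  total_computable f -> (forall i, total_computable (g i)) ->
  total_computable (fun x => f (mktuple (fun i => g i x))).
Proof.
(* Since ['I_m] is finite, codes for all the [g i] are chosen at once without a choice axiom. *)
move=> [cf cfP] /fin_all_exists[cg cgP]; exists (Comp cf cg) => x v; split.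
  move=> fv; exists (mktuple (fun i => g i x)); split; last exact/cfP.
  by move=> i; apply/cgP; rewrite tnth_mktuple.
case=> w [gw /cfP <-]; congr (Some (f _)).
by apply: eq_from_tnth => i; rewrite tnth_mktuple; case/cgP: (gw i).
Qed.

Lemma total_computable_const n k : total_computable (fun _ : n.-tuple nat => k).
Proof.
elim: k => [|k IHk].
  by exists (Zero n) => x v; split=> [[<-]|/= ->].
have succ_computable : total_computable (fun x : 1.-tuple nat => (thead x).+1).
  by exists Succ => x v; split=> [[<-]|/= ->].
apply: eq_total_computable (total_computable_comp succ_computable (fun=> IHk)).
by move=> x; rewrite /thead tnth_mktuple.
Qed.

(** Parameter-free primitive recursion does the case split: the base value is [a] and every step
    returns the constant [b]. *)
Lemma total_computable_ifz a b :
  total_computable (fun x : 1.-tuple nat => if thead x == 0 then a else b).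
Proof.
have [ca caP] := total_computable_const 0 a.
have [cb cbP] := total_computable_const 2 b.
exists (Prec ca cb) => x v /=.
elim: (thead x) v => [|k IHk] v /=; first exact: caP.
split=> [bv|[w [_ /cbP//]]].
(* [Prec] is strict: the step ignores the value at [k], yet that value must be exhibited. *)
by exists (if k == 0 then a else b); split; [apply/IHk | apply/cbP].
Qed.

Lemma total_computable_if_comp (chi : 1.-tuple nat -> nat) a b :
  total_computable chi ->
  total_computable (fun x : 1.-tuple nat => if chi x == 0 then a else b).
Proof.
move=> chiP.
apply: eq_total_computable
  (total_computable_comp (total_computable_ifz a b) (fun=> chiP)).
by move=> x; rewrite /thead tnth_mktuple.
Qed.

(** The self-application map of the recursion theorem: [x] is both the program and its own input. *)
Lemma total_computable_diag (s : 3.-tuple nat -> nat) u :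
  total_computable s ->
  total_computable
    (fun x : 1.-tuple nat => s [tuple of u :: thead x :: [tuple thead x]]).
Proof.
move=> sP.
pose g (i : 'I_3) (x : 1.-tuple nat) := if i == ord0 then u else tnth x ord0.
have gP i : total_computable (g i).
  rewrite /g; case: (i == ord0).
    exact: total_computable_const.
  exact: total_computable_proj.
apply: eq_total_computable (total_computable_comp sP gP) => x.
congr s; apply: eq_from_tnth => i; rewrite tnth_mktuple /g.
by case: i => [[|[|[|]]]] //= i3; rewrite (tnth_nth 0).
Qed.

Theorem sim_fixpoint (phi : programming_model) (pi : abstract_semantics) n
    (f : 1.-tuple nat -> nat) :
  fair pi -> strong_smn phi pi -> 1 <= n -> total_computable f ->
  exists p, sim pi n p (f [tuple p]).
Proof.
move=> fair_pi smn n_gt0 fP.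
have [_ trans sym] := sem_eq_equiv pi.
have [u uP] := fair_pi n.
have [s [sP smnP]] := smn 1 n isT n_gt0.
have [b bP] :=
  prog_complete phi _ _
    (total_computable_comp fP (fun=> total_computable_diag u sP)).
exists (s [tuple of u :: b :: [tuple b]]).
(* With [p] the witness, smn relates [pi p n] to [pi u n.+1] with first argument [phi b 1
   [tuple b]]; by choice of [b] this argument is [f [tuple p]], and fairness of [u] leads to [pi (f
   [tuple p]) n]. *)
apply: trans (sym _ _ (smnP _ _ _)) _; rewrite bP; apply: sym.
rewrite (_ : mktuple _ = [tuple s [tuple of u :: b :: [tuple b]]]).
  exact: uP.
by apply: eq_from_tnth => i; rewrite tnth_mktuple ord1.
Qed.

Theorem mainTheorem2 (phi : programming_model) (pi : abstract_semantics)
    (n : nat) (A : nat -> Prop) :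
  fair pi -> strong_smn phi pi -> 1 <= n ->
  partially_extensional (sim pi n) A ->
  ~ universally_extensional (sim pi n) A ->
  ~ recursive A.
Proof.
move=> fair_pi smn n_gt0 [a aA] notuniv [chi [chiP chiA]]; apply: notuniv => b.
have sim_sym x y : sim pi n x y -> sim pi n y x.
  by have [_ _ sym] := sem_eq_equiv pi; exact: sym.
(* It remains to show that the class of an arbitrary [b] meets [A]. The fixed point [p] is
   equivalent to [b] if [chi] is nonzero at [p], and to [a] otherwise; the latter puts [p] in [A],
   so [p] outside [A] is impossible. *)
have [p pP] :=
  sim_fixpoint fair_pi smn n_gt0 (total_computable_if_comp a b chiP).
have [chi1 chi0] := chiA p.
case: (classic (A p)) => Ap.
  exists p; split=> //.
  by move: pP; rewrite chi1 // => /sim_sym.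
case: (Ap); apply: aA.
by move: pP; rewrite chi0 // => /sim_sym.
Qed.
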